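(* Let $B:\mathbb{R}^n\to\mathbb{R}$ be a control Barrier function for the system $\dot x=f(x)+g(x)u$ with input set $\mathcal{U}=\{u\in\mathbb{R}^m: Au+b\le 0\}$, with associated sets $\mathcal{B}=\{x\in\mathbb{R}^n: B(x)\ge 0\}\subseteq\mathcal{C}\subset\mathbb{R}^n$, and let $\alpha$ be an extended class-$\mathcal{K}$ function. Let $u^{\mathrm{des}}(x)\in\mathcal{U}$ be a given nominal controller and $p_s>0$. Write $F(x)=-\mathcal{L}_fB(x)$, $G(x)=-\mathcal{L}_gB(x)$, $\Lambda(x)=-\alpha(B(x))$. Assume that $G(x)\neq 0$ for $x\in\mathcal{C}$ (relative degree one) and that the problem below is primal non-degenerate on $\mathcal{C}$. For $x\in\mathcal{C}$ let $(s^*(x),u^*(x))$ be the minimizer of $$\min_{s\in\mathbb{R},\,u\in\mathbb{R}^m}\ \tfrac{p_s}{2}(s-1)^2+\tfrac12\|u-u^{\mathrm{des}}(x)\|_2^2\quad\text{subject to}\quad F(x)+G(x)u+s\Lambda(x)\le 0,\qquad Au+b\le 0.$$ Then the optimal control law $x\mapsto u^*(x)$ is locally Lipschitz continuous in $\mathcal{C}$.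
   Context: The system is $\dot x=f(x)+g(x)u$ with $x\in\mathbb{R}^n$, $u\in\mathcal{U}\subset\mathbb{R}^m$, where $f:\mathbb{R}^n\to\mathbb{R}^n$ and $g:\mathbb{R}^n\to\mathbb{R}^{n\times m}$ are Lipschitz continuous. The input set is $\mathcal{U}=\{u\in\mathbb{R}^m: Au+b\le 0\}$ (componentwise inequality) with $A\in\mathbb{R}^{p\times m}$, $b\in\mathbb{R}^p$. An extended class-$\mathcal{K}$ function is a continuous, strictly increasing function $\alpha:(-c,d)\to(-\infty,+\infty)$ with $c,d>0$ and $\alpha(0)=0$ (its domain is understood to contain the values $B(x)$, $x\in\mathcal{C}$). Lie derivatives: $\mathcal{L}_fB(x)=\frac{\partial B(x)}{\partial x}f(x)\in\mathbb{R}$ and $\mathcal{L}_gB(x)=\frac{\partial B(x)}{\partial x}g(x)\in\mathbb{R}^{1\times m}$. A continuously differentiable $B:\mathbb{R}^n\to\mathbb{R}$ is a control Barrier function for the set $\mathcal{B}$ if there exist some extended class-$\mathcal{K}$ function $\alpha_0$ and a set $\mathcal{C}$ with $\mathcal{B}\subseteq\mathcal{C}\subset\mathbb{R}^n$ such that for every $x\in\mathcal{C}$, $\sup_{u\in\mathcal{U}}[\mathcal{L}_fB(x)+\mathcal{L}_gB(x)u+\alpha_0(B(x))]\ge 0$. Here $\mathcal{B}$ is the zero-super level set of $B$. Primal non-degenerate on $\mathcal{C}$ means: for each $x\in\mathcal{C}$, the gradients with respect to $(s,u)$ of the constraints active at $(s^*(x),u^*(x))$ (that is, $(\Lambda(x),G(x))$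 if the Barrier constraint holds with equality, together with $(0,A_i)$ for those rows $A_i$ of $A$ with $A_iu^*(x)+b_i=0$) are linearly independent.
   Formalization: The formal theorem also assumes that the gradient of B is locally Lipschitz on C, that α is locally Lipschitz on its domain, and that u^des is locally Lipschitz on C; without any one of these the claim is false (e.g. a discontinuous u^des with the barrier constraint inactive gives u* = u^des). *)

(* Defs.v *)
From HB Require Import structures.
From mathcomp Require Import all_boot all_order all_algebra.
From mathcomp Require Import all_classical all_reals all_analysis.
Set Implicit Arguments.
Unset Strict Implicit.
Unset Printing Implicit Defensive.
Import Order.TTheory GRing.Theory Num.Theory.
Import numFieldNormedType.Exports.
Local Open Scope classical_set_scope.
Local Open Scope ring_scope.

(* A is not assumed open: only the points of A near x are compared.  The norms
   are those of the library, i.e. the sup norm on matrices. *)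
Definition locally_lipschitz_on (R : realType) (V W : normedModType R)
    (h : V -> W) (A : set V) : Prop :=
  forall x, A x -> exists2 N, nbhs x N & [lipschitz h y | y in A `&` N].

(* The open interval (-c, d); c and d are extended so that (-oo, +oo), needed
   as soon as B is unbounded on C, is allowed. *)
Definition classK_domain (R : realType) (c d : \bar R) : set R :=
  [set r | (- c < r%:E)%E /\ (r%:E < d)%E].

(* The values of alpha outside (-c, d) are irrelevant. *)
Definition ext_class_K (R : realType) (c d : \bar R) (alpha : R -> R) : Prop :=
  [/\ (0 < c)%E, (0 < d)%E,
      {within classK_domain c d, continuous alpha},
      forall r t, classK_domain c d r -> classK_domain c d t ->
        r < t -> alpha r < alpha t
    & alpha 0 = 0].

Definition gradient (R : realType) (n : nat) (B : 'cV[R]_n -> R)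
    (x : 'cV[R]_n) : 'rV[R]_n :=
  \row_j 'D_(delta_mx j 0) B x.

Definition continuously_differentiable (R : realType) (n : nat)
    (B : 'cV[R]_n -> R) : Prop :=
  (forall x, differentiable B x) /\ continuous (gradient B).

Definition lie_f (R : realType) (n : nat) (f : 'cV[R]_n -> 'cV[R]_n)
    (B : 'cV[R]_n -> R) (x : 'cV[R]_n) : R :=
  (gradient B x *m f x) 0 0.

Definition lie_g (R : realType) (n m : nat) (g : 'cV[R]_n -> 'M[R]_(n, m))
    (B : 'cV[R]_n -> R) (x : 'cV[R]_n) : 'rV[R]_m :=
  gradient B x *m g x.

Definition input_set (R : realType) (m p : nat) (A : 'M[R]_(p, m))
    (b : 'cV[R]_p) : set 'cV[R]_m :=
  [set u | forall i, (A *m u + b) i 0 <= 0].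

Definition zero_superlevel (R : realType) (n : nat) (B : 'cV[R]_n -> R) :
    set 'cV[R]_n :=
  [set x | 0 <= B x].

(* The supremum is taken in the extended reals: it may be +oo, and it is -oo
   when U is empty. *)
Definition control_barrier_function (R : realType) (n m : nat)
    (f : 'cV[R]_n -> 'cV[R]_n) (g : 'cV[R]_n -> 'M[R]_(n, m))
    (U : set 'cV[R]_m) (B : 'cV[R]_n -> R) (C : set 'cV[R]_n) : Prop :=
  [/\ continuously_differentiable B,
      zero_superlevel B `<=` C
    & exists (c0 d0 : \bar R) (alpha0 : R -> R),
      [/\ ext_class_K c0 d0 alpha0,
          forall x, C x -> classK_domain c0 d0 (B x)
        & forall x, C x ->
            (0 <= ereal_sup
              [set (lie_f f B x + (lie_g g B x *m u) 0 0
                      + alpha0 (B x))%:E | u in U])%E]].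

Definition barrier_lhs (R : realType) (m : nat) (F : R) (G : 'rV[R]_m)
    (Lam : R) (s : R) (u : 'cV[R]_m) : R :=
  F + (G *m u) 0 0 + s * Lam.

Definition qp_cost (R : realType) (m : nat) (ps : R) (ud : 'cV[R]_m)
    (s : R) (u : 'cV[R]_m) : R :=
  ps / 2 * (s - 1) ^+ 2 + 1 / 2 * \sum_i ((u - ud) i 0) ^+ 2.

Definition qp_feasible (R : realType) (m p : nat) (F : R) (G : 'rV[R]_m)
    (Lam : R) (A : 'M[R]_(p, m)) (b : 'cV[R]_p) (s : R) (u : 'cV[R]_m) : Prop :=
  barrier_lhs F G Lam s u <= 0 /\ input_set A b u.

Definition qp_minimizer (R : realType) (m p : nat) (ps : R) (ud : 'cV[R]_m)
    (F : R) (G : 'rV[R]_m) (Lam : R) (A : 'M[R]_(p, m)) (b : 'cV[R]_p)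
    (s : R) (u : 'cV[R]_m) : Prop :=
  qp_feasible F G Lam A b s u /\
  forall s' u', qp_feasible F G Lam A b s' u' ->
    qp_cost ps ud s u <= qp_cost ps ud s' u'.

(* One entry per active constraint, so that freeness of this sequence also
   rules out two active constraints with the same gradient. *)
Definition active_gradients (R : realType) (m p : nat) (F : R) (G : 'rV[R]_m)
    (Lam : R) (A : 'M[R]_(p, m)) (b : 'cV[R]_p) (s : R) (u : 'cV[R]_m) :
    seq 'rV[R]_(1 + m) :=
  (if barrier_lhs F G Lam s u == 0 then [:: row_mx Lam%:M G] else [::]) ++
  [seq row_mx 0 (row i A) | i <- enum 'I_p & (A *m u + b) i 0 == 0].

Definition primal_nondegenerate (R : realType) (m p : nat) (F : R)
    (G : 'rV[R]_m) (Lam : R) (A : 'M[R]_(p, m)) (b : 'cV[R]_p)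
    (s : R) (u : 'cV[R]_m) : Prop :=
  free (active_gradients F G Lam A b s u).

(* Main.v *)
Require Import Defs.
From HB Require Import structures.
From mathcomp Require Import all_boot all_order all_algebra.
From mathcomp Require Import all_classical all_reals all_analysis.
From mathcomp Require Import ring lra.
Set Implicit Arguments.
Unset Strict Implicit.
Unset Printing Implicit Defensive.
Import Order.TTheory GRing.Theory Num.Theory.
Import numFieldNormedType.Exports.
Local Open Scope classical_set_scope.
Local Open Scope ring_scope.

(** Replacing the slack [s] by [sqrt ps * s] turns the cost of the quadratic
    program into half the squared Euclidean distance, so the minimizer is the
    projection of the target [(sqrt ps, udes x)] onto a fixed polyhedron cut by
    a single half-space [dot a z + r <= 0] that moves with the state.  The
    projection onto a moving convex set is in general only Hoelder continuous
    of order 1/2; the half-space form of the motion and the independence of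
    the active gradients improve this to Lipschitz continuity.

    Only the moving constraint gets a Lagrange multiplier; the fixed polyhedron
    stays in the form of a variational inequality ([multiplier]).  Independence
    gives a direction [v] along which the moving constraint varies while every
    active fixed constraint stays active ([free_cons_dual],
    [nondegenerate_transversal]).  Testing optimality along [v] and [-v] forces
    the multiplier to be [dot (y - z) v / dot a v], and this formula does
    define one ([transversal_multiplier]), so no duality theorem is involved.
    It is moreover Lipschitz in the data and in [z], because the same [v]
    serves for all nearby data: projections depend continuously on the data
    ([projection_continuous]), hence inactive constraints stay inactive
    ([transversal_near]).

    Writing [D] for the distance between two projections and [eps] for that of
    their data, adding the two optimality conditions ([two_point_estimate])
    bounds [D ^ 2] by terms in [eps * D] and the product of [eps] with the
    difference of the multipliers.  As the latter is [O(eps + D)], this reads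
    [D ^ 2 <= M * eps * (eps + D)], whence [D = O(eps)]
    ([projection_lipschitz_near]).

    It remains that the data are locally Lipschitz functions of the state:
    they are built by products and compositions from locally Lipschitz maps
    and from [B], which is locally Lipschitz because it is continuously
    differentiable. *)

(** * Sup norm and Euclidean inner product *)

Section MatrixNorm.
Context (R : realType).

Lemma norm_entry_le p q (M : 'M[R]_(p, q)) i j : `|M i j| <= `|M|.
Proof.
rewrite [`|M|]mx_normrE.
exact: (le_bigmax_cond _ (fun ij => `|M ij.1 ij.2|) (isT : predT (i, j))).
Qed.

Lemma norm_mx_le p q (M : 'M[R]_(p, q)) (c : R) :
  0 <= c -> (forall i j, `|M i j| <= c) -> `|M| <= c.
Proof. by move=> c0 Mc; rewrite [`|M|]mx_normrE; apply: bigmax_le. Qed.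

End MatrixNorm.

Definition dot (R : realType) (k : nat) (u v : 'cV[R]_k) : R := (u^T *m v) 0 0.

Section Dot.
Context (R : realType) (k : nat).
Implicit Types (u v w : 'cV[R]_k) (t : R).

Lemma dot_sum u v : dot u v = \sum_i u i 0 * v i 0.
Proof. by rewrite /dot mxE; apply: eq_bigr => i _; rewrite mxE. Qed.

Lemma dotC u v : dot u v = dot v u.
Proof. by rewrite !dot_sum; apply: eq_bigr => i _; rewrite mulrC. Qed.

Lemma dotDr u v w : dot u (v + w) = dot u v + dot u w.
Proof. by rewrite /dot mulmxDr mxE. Qed.

Lemma dotNr u v : dot u (- v) = - dot u v.
Proof. by rewrite /dot mulmxN mxE. Qed.

Lemma dotZr u t v : dot u (t *: v) = t * dot u v.
Proof. by rewrite /dot -scalemxAr mxE. Qed.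

Lemma dotDl u v w : dot (u + v) w = dot u w + dot v w.
Proof. by rewrite ![dot _ w]dotC dotDr. Qed.

Lemma dotNl u v : dot (- u) v = - dot u v.
Proof. by rewrite ![dot _ v]dotC dotNr. Qed.

Lemma dotZl u t v : dot (t *: u) v = t * dot u v.
Proof. by rewrite ![dot _ v]dotC dotZr. Qed.

Definition dotE := (dotDl, dotDr, dotNl, dotNr, dotZl, dotZr).

(** With [dot_le], the comparison of the sup norm with the inner product that
    makes all estimates possible without a Euclidean norm. *)
Lemma normM_le_dot v : `|v| * `|v| <= dot v v.
Proof.
have [->|v0] := eqVneq v 0; first by
  rewrite normr0 mul0r dot_sum sumr_ge0 // => i _; rewrite -expr2 sqr_ge0.
have [[i j] /= vE] :=
  @mx_norm_neq0 _ _ _ v (contra_neq (@mx_norm_eq0 _ _ _ _) v0).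
rewrite [`|v|]vE (ord1 j) -normrM -expr2 ger0_norm ?sqr_ge0 // expr2.
rewrite dot_sum (bigD1 i) //= -expr2 lerDl sumr_ge0 // => l _.
by rewrite -expr2 sqr_ge0.
Qed.

Lemma dot_le u v (a b : R) :
  `|u| <= a -> `|v| <= b -> `|dot u v| <= k%:R * a * b.
Proof.
move=> ua vb; rewrite dot_sum (le_trans (ler_norm_sum _ _ _)) //.
have -> : k%:R * a * b = \sum_(i < k) (a * b).
  by rewrite sumr_const card_ord -mulrA mulr_natl.
apply: ler_sum => i _; rewrite normrM ler_pM //.
  exact: le_trans (norm_entry_le _ _ _) ua.
exact: le_trans (norm_entry_le _ _ _) vb.
Qed.

End Dot.

(** * Projection onto a polyhedron cut by one more half-space *)

Definition is_projection (R : realType) (k : nat) (P : set 'cV[R]_k)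
    (y z : 'cV[R]_k) : Prop :=
  P z /\ forall w, P w -> dot (z - y) (z - y) <= dot (w - y) (w - y).

(** The half-space given by [a] and [r] is kept apart from the rows of [N]
    because it is the only constraint that will move. *)
Definition cut_polyhedron (R : realType) (k p : nat) (a : 'cV[R]_k) (r : R)
    (N : 'M[R]_(p, k)) (b : 'cV[R]_p) : set 'cV[R]_k :=
  [set z | dot a z + r <= 0] `&` input_set N b.

(** Smallness conditions on a step length or a radius [t] take this form; the second premise is what an active constraint requires. *)
Lemma affine_le0_near (R : realType) (c s : R) :
  c <= 0 -> (c = 0 -> s <= 0) -> \forall t \near 0^'+, c + t * s <= 0.
Proof.
rewrite le_eqVlt => /predU1P[->/(_ erefl) s0|c0 _].
  by near=> t; rewrite add0r mulr_ge0_le0.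
have e0 : 0 < - c / (`|s| + 1) by rewrite divr_gt0 ?oppr_gt0// ltr_wpDl.
near=> t.
have t0 : 0 < t by [].
have : t < - c / (`|s| + 1) by near: t; apply: nbhs_right_lt.
rewrite ltr_pdivlMr ?ltr_wpDl// => tc.
have := ler_wpM2l (ltW t0) (ler_norm s).
by move: tc; rewrite mulrDr; lra.
Unshelve. all: by end_near. Qed.

(** The squared distance to [y] at [z + t *: d] has derivative
    [- 2 * dot (y - z) d] at [t = 0], which minimality makes nonnegative. *)
Lemma projection_dir_le0 (R : realType) (k : nat) (P : set 'cV[R]_k)
    (y z d : 'cV[R]_k) :
  is_projection P y z -> (\forall t \near 0^'+, P (z + t *: d)) ->
  dot (y - z) d <= 0.
Proof.
move=> [_ zmin] Pd; rewrite leNgt; apply/negP => q0.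
have small : \forall t \near 0^'+, - dot (y - z) d + t * dot d d <= 0.
  by apply: affine_le0_near => [|/eqP]; lra.
near (0 : R)^'+ => t.
have t0 : 0 < t by [].
have Pt : P (z + t *: d) by near: t.
have st : - dot (y - z) d + t * dot d d <= 0 by near: t.
have := zmin _ Pt; rewrite (_ : z + t *: d - y = (z - y) + t *: d); last first.
  by rewrite addrAC.
have := ler_wpM2l (ltW t0) st.
have := mulr_gt0 t0 q0.
rewrite !dotE [dot d z]dotC [dot d y]dotC; nra.
Unshelve. all: by end_near. Qed.

Section Multiplier.
Context (R : realType) (k p : nat) (N : 'M[R]_(p, k)) (b : 'cV[R]_p).
Implicit Types (a v w y z d : 'cV[R]_k) (r lam : R).

(** Only active constraints restrict the admissible directions: the others are
    strict at [z] and survive a short step. *)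
Lemma projection_critical_le0 a r y z d :
  is_projection (cut_polyhedron a r N b) y z ->
  (dot a z + r = 0 -> dot a d <= 0) ->
  (forall i, (N *m z + b) i 0 = 0 -> (N *m d) i 0 <= 0) ->
  dot (y - z) d <= 0.
Proof.
move=> zP ad Nd; apply: (projection_dir_le0 zP).
case: zP => -[/= az Nz] _.
have Na : \forall t \near 0^'+, dot a z + r + t * dot a d <= 0.
  exact: affine_le0_near.
have NN : \forall t \near 0^'+,
    forall i, (N *m z + b) i 0 + t * (N *m d) i 0 <= 0.
  by apply: filter_forall => i; apply: affine_le0_near; [exact: Nz|exact: Nd].
apply: filterS2 Na NN => t at_le0 Nt_le0; split => /=.
  by rewrite dotDr dotZr addrAC.
move=> i; rewrite mulmxDr -scalemxAr.
by have := Nt_le0 i; rewrite !mxE addrAC.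
Qed.

Lemma projection_le0 a r y z w :
  is_projection (cut_polyhedron a r N b) y z ->
  cut_polyhedron a r N b w -> dot (y - z) (w - z) <= 0.
Proof.
move=> zP [/= aw Nw]; apply: (projection_critical_le0 zP).
  by rewrite dotDr dotNr; lra.
move=> i; have := Nw i; rewrite mulmxBr !mxE; lra.
Qed.

(** The third clause says that [y - z - lam *: a] is normal at [z] to the fixed
    polyhedron; the multipliers of its rows are left implicit. *)
Definition multiplier a r y z lam : Prop :=
  [/\ 0 <= lam, lam * (dot a z + r) = 0
    & forall w, input_set N b w -> dot (y - z) (w - z) <= lam * dot a (w - z)].

Lemma inactive_multiplier a r y z :
  is_projection (cut_polyhedron a r N b) y z -> dot a z + r < 0 ->
  multiplier a r y z 0.
Proof.
move=> zP az; split; rewrite ?mul0r // => w Nw; rewrite mul0r.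
apply: (projection_critical_le0 zP) => [|i]; first lra.
by have := Nw i; rewrite mulmxBr !mxE; lra.
Qed.

(** Along [v] the moving constraint strictly increases, while the active rows of
    the fixed polyhedron stay active. *)
Definition transversal_dir a z v : Prop :=
  0 < dot a v /\ forall i, (N *m z + b) i 0 = 0 -> (N *m v) i 0 = 0.

(** Nonnegativity comes from the direction [- v], and complementarity from both
    [v] and [- v], which are admissible when the half-space is not active.  For
    the normality, a direction [w - z] into the fixed polyhedron is corrected
    by a multiple of [v] so as to be tangent to the half-space; optimality
    along the corrected direction is the claim. *)
Lemma transversal_multiplier a r y z v :
  is_projection (cut_polyhedron a r N b) y z -> transversal_dir a z v ->
  multiplier a r y z (dot (y - z) v / dot a v).
Proof.
move=> zP [av Nv]; have az : dot a z + r <= 0 by case: zP => -[].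
have le0 : 0 <= dot (y - z) v.
  have := @projection_critical_le0 a r y z (- v) zP.
  rewrite !dotNr mulmxN => H; rewrite -oppr_le0; apply: H; first lra.
  by move=> i /Nv Nvi; rewrite [leLHS]mxE Nvi oppr0.
split; first by rewrite divr_ge0// ltW.
- have [->|az0] := eqVneq (dot a z + r) 0; first by rewrite mulr0.
  suff -> : dot (y - z) v = 0 by rewrite !mul0r.
  apply: le_anti; rewrite le0 andbT.
  apply: (projection_critical_le0 zP); first by move/eqP; rewrite (negPf az0).
  by move=> i /Nv ->.
- move=> w Nw; set c := dot a (w - z) / dot a v.
  have := @projection_critical_le0 a r y z (w - z - c *: v) zP.
  have cE : c * dot a v = dot a (w - z) by rewrite /c divfK ?gt_eqF.
  have -> : dot (y - z) v / dot a v * dot a (w - z) = c * dot (y - z) v.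
    by rewrite /c; ring.
  rewrite [dot (y - z) (_ - _ - _)]dotDr dotNr dotZr subr_le0; apply.
    by rewrite dotDr dotNr dotZr cE subrr.
  move=> i zi; move: (zi) (Nv i zi) (Nw i).
  rewrite !mulmxBr -scalemxAr.
  move: (N *m z) (N *m v) (N *m w) => Nz' Nv' Nw'.
  by rewrite !mxE => + ->; rewrite mulr0; lra.
Qed.

(** Each normality condition is tested at the other projection.  Complementarity
    and feasibility turn the right-hand sides into the values at [z1] and [z2]
    of the difference of the two affine constraints. *)
Lemma two_point_estimate a1 r1 y1 z1 lam1 a2 r2 y2 z2 lam2 :
  cut_polyhedron a1 r1 N b z1 -> multiplier a1 r1 y1 z1 lam1 ->
  cut_polyhedron a2 r2 N b z2 -> multiplier a2 r2 y2 z2 lam2 ->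
  dot (z1 - z2) (z1 - z2) <= dot (y1 - y2) (z1 - z2)
    + lam1 * dot (a1 - a2) (z2 - z1)
    + (lam1 - lam2) * (dot (a1 - a2) z1 + (r1 - r2)).
Proof.
move=> [/= az1 /[dup] Nz1 _] [l1 c1 H1] [/= az2 Nz2] [l2 c2 H2].
have := H1 _ Nz2; have := H2 _ Nz1.
have := mulr_ge0_le0 l1 az2; have := mulr_ge0_le0 l2 az1.
move: c1 c2; rewrite !dotE.
rewrite [dot z2 z1]dotC.
move=> *; nra.
Qed.

(** Unlike [two_point_estimate], this needs a multiplier at the base problem
    only: the perturbed problem is tested at a feasible point [w] near [z0].
    It thus applies before anything is known about the constraints active
    at [z]. *)
Lemma perturbation_estimate a0 r0 y0 z0 lam0 a r y z w :
  cut_polyhedron a0 r0 N b z0 -> multiplier a0 r0 y0 z0 lam0 ->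
  is_projection (cut_polyhedron a r N b) y z -> cut_polyhedron a r N b w ->
  dot (z - z0) (z - z0) <= dot (y - y0) (z - z0)
    + lam0 * (dot (a0 - a) z + (r0 - r)) + dot (y - z) (z0 - w).
Proof.
move=> [/= az0 Nz0] [l0 c0 H0] zP wP; have := projection_le0 zP wP.
case: zP => -[/= az Nz] _; have := H0 _ Nz; have := mulr_ge0_le0 l0 az.
move: c0; rewrite !dotE [dot z0 z]dotC.
move=> *; nra.
Qed.

End Multiplier.

(** * Stability of the projection under perturbation of the half-space *)

Section Stability.
Context (R : realType) (k p : nat) (N : 'M[R]_(p, k)) (b : 'cV[R]_p).
Implicit Types (a v w y z : 'cV[R]_k) (r e : R).

Lemma row_dot i z : (N *m z) i 0 = dot (row i N)^T z.
Proof. by rewrite /dot trmxK -row_mul [RHS]mxE. Qed.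

Definition data_close e a1 r1 y1 a2 r2 y2 : Prop :=
  [/\ `|a1 - a2| <= e, `|r1 - r2| <= e & `|y1 - y2| <= e].

Lemma data_closeW e e' a1 r1 y1 a2 r2 y2 :
  e <= e' -> data_close e a1 r1 y1 a2 r2 y2 -> data_close e' a1 r1 y1 a2 r2 y2.
Proof. by move=> ee' [? ? ?]; split; apply: le_trans ee'. Qed.

Context (a0 : 'cV[R]_k) (r0 : R) (y0 z0 : 'cV[R]_k).
Hypothesis z0P : is_projection (cut_polyhedron a0 r0 N b) y0 z0.
Hypothesis a0_transversal :
  dot a0 z0 + r0 = 0 -> exists v, transversal_dir N b a0 z0 v.

(** If the half-space is active at [z0], a step of order [e] along [- v] absorbs
    a perturbation of size [e] without leaving the fixed polyhedron; otherwise
    [z0] itself remains feasible. *)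
Lemma feasible_point_near : exists2 K, 0 <= K &
  \forall e \near 0^'+, forall a r, `|a - a0| <= e -> `|r - r0| <= e ->
    exists2 w, cut_polyhedron a r N b w & `|z0 - w| <= K * e.
Proof.
case: z0P => -[/= az0 Nz0] _.
have gap e a r : `|a - a0| <= e -> `|r - r0| <= e ->
    dot a z0 + r <= dot a0 z0 + r0 + e * (k%:R * `|z0| + 1).
  move=> ae re; have := dot_le ae (lexx `|z0|); rewrite ler_norml => /andP[_].
  by move: re; rewrite ler_norml => /andP[_]; rewrite dotDl dotNl; lra.
have [act|inact] := eqVneq (dot a0 z0 + r0) 0; last first.
  exists 0 => //; have neg : dot a0 z0 + r0 < 0 by rewrite lt_neqAle inact.
  have small : \forall e \near 0^'+,
      dot a0 z0 + r0 + e * (k%:R * `|z0| + 1) <= 0.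
    by apply: affine_le0_near => // /eqP; rewrite (negPf inact).
  apply: filterS small => e small a r ae re.
  exists z0; last by rewrite subrr normr0 mul0r.
  by split => //=; apply: le_trans (gap _ _ _ ae re) small.
have [v [av Nv]] := a0_transversal act.
(* The perturbed [a] still satisfies [dot a v >= dot a0 v / 2], so the step
   [e * T] lowers the constraint by at least its maximal excess at [z0]. *)
set T : R := 2 * (k%:R * `|z0| + 1) / dot a0 v.
have T0 : 0 <= T by rewrite divr_ge0 ?ltW// mulr_ge0// addr_ge0// mulr_ge0.
have TE : T * dot a0 v = 2 * (k%:R * `|z0| + 1) by rewrite /T divfK// gt_eqF.
exists (T * `|v|); first by rewrite mulr_ge0.
have av_small : \forall e \near 0^'+, - (dot a0 v / 2) + e * (k%:R * `|v|) <= 0.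
  by apply: affine_le0_near => [|/eqP]; lra.
have N_small : \forall e \near 0^'+,
    forall i, (N *m z0 + b) i 0 + e * - (T * (N *m v) i 0) <= 0.
  apply: filter_forall => i; apply: affine_le0_near; first exact: Nz0.
  by move=> /Nv ->; rewrite mulr0 oppr0.
near=> e => a r ae re; have e0 : 0 < e by [].
exists (z0 - (e * T) *: v); last first.
  have eT0 : 0 <= e * T by apply: mulr_ge0 T0; exact: ltW.
  rewrite opprB addrC subrK normrZ (ger0_norm eT0).
  lra.
split => [/=|i].
  have := gap _ _ _ ae re; rewrite act dotDr dotNr dotZr.
  have : dot a0 v / 2 <= dot a v.
    have : - (dot a0 v / 2) + e * (k%:R * `|v|) <= 0 by near: e.
    have := dot_le ae (lexx `|v|); rewrite ler_norml => /andP[+ _].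
    by rewrite dotDl dotNl; lra.
  move=> avv; have := ler_wpM2l (mulr_ge0 (ltW e0) T0) avv.
  have -> : e * T * (dot a0 v / 2) = e * (k%:R * `|z0| + 1).
    by rewrite -mulrA [T * _]mulrA TE; lra.
  lra.
have : forall i, (N *m z0 + b) i 0 + e * - (T * (N *m v) i 0) <= 0 by near: e.
move/(_ i); rewrite mulmxBr -scalemxAr.
by move: (N *m z0) (N *m v) => ? ?; rewrite !mxE; lra.
Unshelve. all: by end_near. Qed.

Lemma base_multiplier : exists lam, multiplier N b a0 r0 y0 z0 lam.
Proof.
have [act|inact] := eqVneq (dot a0 z0 + r0) 0.
  have [v tv] := a0_transversal act.
  by eexists; apply: transversal_multiplier tv.
exists 0; apply: inactive_multiplier => //.
by case: z0P => -[/= az0 _] _; rewrite lt_neqAle inact.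
Qed.

(** With [E] the distance to [z0], [perturbation_estimate] yields
    [E * E <= e * M * (1 + E)], which forces [E] to be small with [e]. *)
Lemma projection_continuous rho : 0 < rho ->
  \forall e \near 0^'+, forall a r y z, data_close e a r y a0 r0 y0 ->
    is_projection (cut_polyhedron a r N b) y z -> `|z - z0| <= rho.
Proof.
move=> rho0; have [lam lamP] := base_multiplier.
have lam0 : 0 <= lam by case: lamP.
have [K K0 feas] := feasible_point_near.
set M := k%:R + lam * (k%:R * (`|z0| + 1) + 1) + k%:R * K * (`|y0 - z0| + 2).
have small : \forall e \near 0^'+, - rho ^+ 2 + e * (M * (1 + rho)) <= 0.
  apply: affine_le0_near => [|/eqP]; first by rewrite oppr_le0 sqr_ge0.
  by rewrite oppr_eq0 sqrf_eq0 gt_eqF.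
near=> e => a r y z [ae re ye] zP.
have e0 : 0 < e by [].
have e1 : e < 1 by near: e; apply: nbhs_right_lt.
have [w wP wz] : exists2 w, cut_polyhedron a r N b w & `|z0 - w| <= K * e.
  by move: a r ae re {zP}; near: e.
set E := `|z - z0|.
have zE : `|z| <= `|z0| + E by rewrite -{1}(subrK z0 z) addrC ler_normD.
have yzE : `|y - z| <= `|y0 - z0| + 1 + E.
  apply: le_trans (ler_distD z0 _ _) _; rewrite [`|z0 - z|]distrC lerD2r.
  apply: le_trans (ler_distD y0 _ _) _.
  by rewrite addrC lerD2l (le_trans ye) ?ltW.
have := perturbation_estimate (proj1 z0P) lamP zP wP.
have := normM_le_dot (z - z0); rewrite -/E.
move=> EE main.
have d3 := le_trans (ler_norm _) (dot_le ye (lexx E)).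
have ae' : `|a0 - a| <= e by rewrite distrC.
have d2 := le_trans (ler_norm _) (dot_le ae' zE).
have d1 := le_trans (ler_norm _) (dot_le yzE wz).
have E0 : 0 <= E by rewrite /E.
have rd : r0 - r <= e by apply: ler_normlW; rewrite distrC.
have d2' := ler_wpM2l lam0 (lerD d2 rd).
have bound : E * E <= e * M * (1 + E).
  have k0 : 0 <= k%:R :> R by [].
  apply: le_trans (le_trans EE main) _.
  apply: le_trans (lerD (lerD d3 d2') d1) _.
  have Z0 : 0 <= `|z0| by []. have Y0 : 0 <= `|y0 - z0| by [].
  move: Z0 Y0 e0 E0 k0 lam0 K0; rewrite /M; clear.
  move: (`|z0|) (`|y0 - z0|) (k%:R : R) E => Z Y c E Z0 Y0 e0 E0 c0 lam0 K0.
  have := mulr_ge0 (ltW e0) c0.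
  have := mulr_ge0 (mulr_ge0 (ltW e0) lam0) (mulr_ge0 c0 (mulr_ge0 Z0 E0)).
  have := mulr_ge0 (mulr_ge0 (ltW e0) lam0) E0.
  have := mulr_ge0 (mulr_ge0 (ltW e0) lam0) c0.
  have := mulr_ge0 (mulr_ge0 (ltW e0) (mulr_ge0 c0 K0)) (mulr_ge0 Y0 E0).
  have := mulr_ge0 (mulr_ge0 (ltW e0) (mulr_ge0 c0 K0)) E0.
  have := mulr_ge0 (ltW e0) (mulr_ge0 c0 K0).
  lra.
have eM : e * (M * (1 + rho)) <= rho ^+ 2.
  by rewrite -subr_le0 addrC; near: e.
rewrite leNgt; apply/negP => rE.
have := ler_wpM2r (addr_ge0 ler01 (ltW rho0)) bound.
have := ler_wpM2r (addr_ge0 ler01 E0) eM.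
have Er : 0 < E - rho by rewrite subr_gt0.
have := mulr_gt0 (mulr_gt0 rho0 (lt_trans rho0 rE)) Er.
nra.
Unshelve. all: by end_near. Qed.

Lemma inactive_near : dot a0 z0 + r0 < 0 ->
  \forall e \near 0^'+, forall a r z, `|a - a0| <= e -> `|r - r0| <= e ->
    `|z - z0| <= e -> dot a z + r < 0.
Proof.
move=> neg; set c := dot a0 z0 + r0 in neg.
have small : \forall e \near 0^'+,
    c / 2 + e * (k%:R * `|a0| + k%:R * (`|z0| + 1) + 1) <= 0.
  by apply: affine_le0_near => [|/eqP]; lra.
near=> e => a r z ae re ze.
have e1 : e < 1 by near: e; apply: nbhs_right_lt.
have : c / 2 + e * (k%:R * `|a0| + k%:R * (`|z0| + 1) + 1) <= 0 by near: e.
have zE : `|z| <= `|z0| + 1.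
  rewrite -(subrK z0 z) addrC (le_trans (ler_normD _ _))// lerD2l.
  by rewrite (le_trans ze) ?ltW.
have := le_trans (ler_norm _) (dot_le (lexx `|a0|) ze).
have := le_trans (ler_norm _) (dot_le ae zE).
have := le_trans (ler_norm _) re.
by move: neg; rewrite /c !dotE; lra.
Unshelve. all: by end_near. Qed.

Lemma transversal_near v : transversal_dir N b a0 z0 v ->
  \forall e \near 0^'+, forall a z, `|a - a0| <= e -> `|z - z0| <= e ->
    dot a0 v / 2 <= dot a v /\ transversal_dir N b a z v.
Proof.
move=> [av Nv]; case: z0P => -[/= _ Nz0] _.
have av_small : \forall e \near 0^'+, - (dot a0 v / 2) + e * (k%:R * `|v|) <= 0.
  by apply: affine_le0_near => [|/eqP]; lra.
have N_small : \forall e \near 0^'+, forall i, (N *m z0 + b) i 0 < 0 ->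
    (N *m z0 + b) i 0 / 2 + e * (k%:R * `|(row i N)^T|) <= 0.
  apply: filter_forall => i.
  have [neg|] := ltP ((N *m z0 + b) i 0) 0; last by move=> _; apply: nearW.
  have : \forall e \near 0^'+,
     (N *m z0 + b) i 0 / 2 + e * (k%:R * `|(row i N)^T|) <= 0.
    by apply: affine_le0_near => [|/eqP]; lra.
  by apply: filterS.
near=> e => a z ae ze.
have avv : dot a0 v / 2 <= dot a v.
  have : - (dot a0 v / 2) + e * (k%:R * `|v|) <= 0 by near: e.
  have := dot_le ae (lexx `|v|); rewrite ler_norml => /andP[+ _].
  by rewrite dotDl dotNl; lra.
split => //; split => [|i zi]; first by apply: lt_le_trans avv; lra.
apply: Nv; apply/eqP; rewrite eq_le Nz0 /= leNgt; apply/negP => neg.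
have : forall i, (N *m z0 + b) i 0 < 0 ->
  (N *m z0 + b) i 0 / 2 + e * (k%:R * `|(row i N)^T|) <= 0 by near: e.
move=> /(_ i neg).
have := le_trans (ler_norm _) (dot_le (lexx `|(row i N)^T|) ze).
rewrite -row_dot mulmxBr.
move: zi neg; move: (N *m z) (N *m z0) => ? ?; rewrite !mxE; lra.
Unshelve. all: by end_near. Qed.

(** The multiplier is given by an explicit formula: zero when the half-space
    is inactive at [z0], and the quotient of [transversal_multiplier], with [v]
    fixed once for all nearby data, when it is active. *)
Lemma multiplier_lipschitz :
  exists (ell : 'cV[R]_k -> 'cV[R]_k -> 'cV[R]_k -> R),
  exists2 K, 0 <= K & \forall e \near 0^'+,
    (forall a r y z, data_close e a r y a0 r0 y0 -> `|z - z0| <= e ->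
       is_projection (cut_polyhedron a r N b) y z ->
       multiplier N b a r y z (ell a y z) /\ ell a y z <= K) /\
    (forall a1 r1 y1 z1 a2 r2 y2 z2 eps,
       data_close e a1 r1 y1 a0 r0 y0 -> `|z1 - z0| <= e ->
       data_close e a2 r2 y2 a0 r0 y0 -> `|z2 - z0| <= e ->
       data_close eps a1 r1 y1 a2 r2 y2 ->
       `|ell a1 y1 z1 - ell a2 y2 z2| <= K * (eps + `|z1 - z2|)).
Proof.
have [act|inact] := eqVneq (dot a0 z0 + r0) 0; last first.
  have neg : dot a0 z0 + r0 < 0.
    by rewrite lt_neqAle inact; case: z0P => -[].
  exists (fun _ _ _ => 0), 0 => //.
  apply: filterS (inactive_near neg) => e small; split.
    move=> a r y z [ae re _] ze zP; split=> //.
    by apply: inactive_multiplier => //; apply: small.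
  by move=> *; rewrite subrr normr0 mul0r.
have [v tv] := a0_transversal act.
have av : 0 < dot a0 v by case: tv.
set Y := `|y0 - z0| + 2; set mu := dot a0 v / 2.
have mu0 : 0 < mu by rewrite divr_gt0.
set K1 : R := k%:R * Y * `|v| / mu.
set K2 : R := (k%:R * `|v| + K1 * (k%:R * `|v|)) / mu.
have Y0 : 0 <= Y by rewrite addr_ge0.
have K10 : 0 <= K1 by rewrite !mulr_ge0 ?invr_ge0// ltW.
have K20 : 0 <= K2.
  by apply: divr_ge0 (ltW mu0); apply: addr_ge0 => //; apply: mulr_ge0 K10 _.
exists (fun a y z => dot (y - z) v / dot a v), (K1 + K2); first exact: addr_ge0.
have near_v := transversal_near tv.
near=> e.
have e1 : e < 1 by near: e; apply: nbhs_right_lt.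
have near_e : forall a z, `|a - a0| <= e -> `|z - z0| <= e ->
    mu <= dot a v /\ transversal_dir N b a z v by near: e.
have ellK a r y z : data_close e a r y a0 r0 y0 -> `|z - z0| <= e ->
    `|dot (y - z) v / dot a v| <= K1.
  move=> [ae re ye] ze; have [avv _] := near_e _ _ ae ze.
  have av0 : 0 < dot a v by apply: lt_le_trans avv.
  have yzY : `|y - z| <= Y.
    apply: le_trans (ler_distD z0 _ _) _; rewrite [`|z0 - z|]distrC.
    have := ler_distD y0 y z0; rewrite /Y; lra.
  rewrite normrM normfV (gtr0_norm av0) ler_pM ?invr_ge0 ?(ltW av0)//.
    exact: dot_le.
  by rewrite lef_pV2.
split=> [a r y z ce ze zP
        |a1 r1 y1 z1 a2 r2 y2 z2 eps ce1 ze1 ce2 ze2 [aE rE yE]].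
  have [ae _ _] := ce; have [avv tz] := near_e _ _ ae ze.
  split; first exact: transversal_multiplier.
  by rewrite (le_trans (ler_norm _))// (le_trans (ellK _ _ _ _ ce ze))// lerDl.
have [ae1 _ _] := ce1; have [avv1 _] := near_e _ _ ae1 ze1.
have [ae2 _ _] := ce2; have [avv2 _] := near_e _ _ ae2 ze2.
have := ellK _ _ _ _ ce2 ze2.
have L1E : dot (y1 - z1) v / dot a1 v * dot a1 v = dot (y1 - z1) v.
  by rewrite divfK// gt_eqF// (lt_le_trans mu0).
have L2E : dot (y2 - z2) v / dot a2 v * dot a2 v = dot (y2 - z2) v.
  by rewrite divfK// gt_eqF// (lt_le_trans mu0).
move: L1E L2E.
move: (dot (y1 - z1) v / _) (dot (y2 - z2) v / _) => l1 l2 L1E L2E l2K.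
have E0 : 0 <= eps by apply: le_trans aE.
set D := `|z1 - z2|.
(* The difference of two quotients is estimated after clearing one of the
   denominators, which is at least [mu]. *)
have split_eq : (l1 - l2) * dot a1 v =
    dot (y1 - y2) v - dot (z1 - z2) v - l2 * dot (a1 - a2) v.
  by move: L1E L2E; rewrite !dotE; lra.
have bnd : `|(l1 - l2) * dot a1 v| <= mu * K2 * (eps + D).
  have K2E : mu * K2 = k%:R * `|v| + K1 * (k%:R * `|v|).
    by rewrite /K2 mulrC divfK// gt_eqF.
  rewrite split_eq K2E.
  have b1 := dot_le yE (lexx `|v|).
  have b2 := dot_le (lexx D) (lexx `|v|).
  have b3 := ler_pM (normr_ge0 _) (normr_ge0 _) l2K (dot_le aE (lexx `|v|)).
  rewrite -normrM in b3.
  apply: le_trans (ler_normB _ _) _.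
  apply: le_trans (lerD (ler_normB _ _) b3) _.
  apply: le_trans (lerD (lerD b1 b2) (lexx _)) _.
  have D0 : 0 <= D by rewrite /D.
  have := mulr_ge0 (mulr_ge0 K10 D0) (mulr_ge0 (ler0n R k) (normr_ge0 v)).
  lra.
rewrite normrM in bnd.
have a1n : mu <= `|dot a1 v| by apply: le_trans (ler_norm _).
have := ler_wpM2l (normr_ge0 (l1 - l2)) a1n => H.
have := le_trans H bnd; rewrite mulrC -mulrA (ler_pM2l mu0) => /le_trans; apply.
by apply: ler_wpM2r; [rewrite addr_ge0// /D|rewrite lerDr].
Unshelve. all: by end_near. Qed.

Theorem projection_lipschitz_near : exists2 K, 0 <= K &
  \forall e \near 0^'+, forall a1 r1 y1 z1 a2 r2 y2 z2 eps,
    data_close e a1 r1 y1 a0 r0 y0 ->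
    is_projection (cut_polyhedron a1 r1 N b) y1 z1 ->
    data_close e a2 r2 y2 a0 r0 y0 ->
    is_projection (cut_polyhedron a2 r2 N b) y2 z2 ->
    data_close eps a1 r1 y1 a2 r2 y2 -> `|z1 - z2| <= K * eps.
Proof.
have [ell [K K0 ellP]] := multiplier_lipschitz.
set M : R := k%:R + K * k%:R + K * (k%:R * (`|z0| + 1) + 1).
have M0 : 0 <= M by rewrite !addr_ge0 ?mulr_ge0 ?addr_ge0 ?mulr_ge0 ?addr_ge0.
exists (M + 1); first by rewrite addr_ge0.
near (0 : R)^'+ => rho.
have rho0 : 0 < rho by [].
have rho1 : rho < 1 by near: rho; apply: nbhs_right_lt.
have [ell_mult ell_lip] :
    (forall a r y z, data_close rho a r y a0 r0 y0 -> `|z - z0| <= rho ->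
       is_projection (cut_polyhedron a r N b) y z ->
       multiplier N b a r y z (ell a y z) /\ ell a y z <= K) /\
    (forall a1 r1 y1 z1 a2 r2 y2 z2 eps,
       data_close rho a1 r1 y1 a0 r0 y0 -> `|z1 - z0| <= rho ->
       data_close rho a2 r2 y2 a0 r0 y0 -> `|z2 - z0| <= rho ->
       data_close eps a1 r1 y1 a2 r2 y2 ->
       `|ell a1 y1 z1 - ell a2 y2 z2| <= K * (eps + `|z1 - z2|)).
  by near: rho.
have contz := projection_continuous rho0.
near=> e => a1 r1 y1 z1 a2 r2 y2 z2 eps ce1 z1P ce2 z2P ceps.
have e_rho : e < rho by near: e; apply: nbhs_right_lt.
have contz_e : forall a r y z, data_close e a r y a0 r0 y0 ->
    is_projection (cut_polyhedron a r N b) y z -> `|z - z0| <= rho by near: e.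
have ze1 := contz_e _ _ _ _ ce1 z1P.
have ze2 := contz_e _ _ _ _ ce2 z2P.
have {}ce1 := data_closeW (ltW e_rho) ce1.
have {}ce2 := data_closeW (ltW e_rho) ce2.
have [m1 l1K] := ell_mult _ _ _ _ ce1 ze1 z1P.
have [m2 _] := ell_mult _ _ _ _ ce2 ze2 z2P.
have l12 := ell_lip _ _ _ _ _ _ _ _ _ ce1 ze1 ce2 ze2 ceps.
have l10 : 0 <= ell a1 y1 z1 by case: m1.
have := two_point_estimate (proj1 z1P) m1 (proj1 z2P) m2.
move: (ell a1 y1 z1) (ell a2 y2 z2) l1K l12 l10 => l1 l2 l1K l12 l10.
have [aE rE yE] := ceps.
have eps0 : 0 <= eps by apply: le_trans aE.
have z1Z : `|z1| <= `|z0| + 1.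
  rewrite -(subrK z0 z1) addrC (le_trans (ler_normD _ _))// lerD2l.
  by rewrite (le_trans ze1) ?ltW.
set D := `|z1 - z2|; have D0 : 0 <= D by rewrite /D.
have := normM_le_dot (z1 - z2); rewrite -/D => DD main.
have b1 := le_trans (ler_norm _) (dot_le yE (lexx D)).
have D_sym : `|z2 - z1| <= D by rewrite distrC.
have b2 := le_trans (ler_norm _) (dot_le aE D_sym).
have keD : 0 <= k%:R * eps * D by rewrite !mulr_ge0.
have b2' := le_trans (ler_wpM2l l10 b2) (ler_wpM2r keD l1K).
have b3 : `|dot (a1 - a2) z1 + (r1 - r2)| <= k%:R * eps * (`|z0| + 1) + eps.
  by apply: le_trans (ler_normD _ _) _; apply: lerD => //; apply: dot_le.
have b4 := ler_pM (normr_ge0 _) (normr_ge0 _) l12 b3.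
rewrite -normrM in b4; have {}b4 := le_trans (ler_norm _) b4.
have bound : D * D <= M * eps * (eps + D).
  apply: le_trans DD (le_trans main _).
  apply: le_trans (lerD (lerD b1 b2') b4) _.
  have k0 : 0 <= k%:R :> R by [].
  have := mulr_ge0 k0 (mulr_ge0 eps0 eps0).
  have := mulr_ge0 K0 (mulr_ge0 k0 (mulr_ge0 eps0 eps0)).
  by rewrite -/D /M; lra.
(* If [D > (M + 1) * eps], then [D - M * eps > eps], so
   [D * (D - M * eps) > D * eps >= M * eps * eps], against [bound]. *)
have Me : 0 <= M * eps by rewrite mulr_ge0.
rewrite leNgt; apply/negP => epsD.
have Dgt : 0 < D by apply: le_lt_trans epsD; rewrite mulr_ge0// addr_ge0.
have gap : eps < D - M * eps by rewrite -subr_gt0; move: epsD; lra.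
have := ltr_pM2l Dgt eps (D - M * eps); rewrite gap => step.
have := ler_wpM2r eps0 (ltW epsD).
move: bound step; rewrite mulrDr mulrBr; nra.
Unshelve. all: by end_near. Qed.

End Stability.

(** * Locally Lipschitz functions *)

Section LocallyLipschitz.
Context (R : realType).
Implicit Types (V W : normedModType R).

(** A form with an explicit constant and radius, in which conditions near [x0]
    combine by the filter of small positive radii. *)
Lemma locally_lipschitz_onP V W (h : V -> W) (A : set V) :
  locally_lipschitz_on h A <->
  forall x0, A x0 -> exists2 L, 0 <= L & \forall e \near 0^'+,
    forall x y, A x -> A y -> `|x - x0| <= e -> `|y - x0| <= e ->
      `|h x - h y| <= L * `|x - y|.
Proof.
split=> hL x0 Ax0.
- have [N /nbhs_normP[e /= e0 eN] NL] := hL _ Ax0.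
  have [L [L0 NLL]] : exists L, 0 <= L /\
      L.-lipschitz_(A `&` N) (fun x => h x).
    near (+oo : set_system R) => L; exists L; split.
      by near: L; exact: nbhs_pinfty_ge.
    by near: L.
  exists L => //; near=> d => x y Ax Ay xd yd.
  have de : d < e by near: d; apply: nbhs_right_lt.
  apply: (NLL (x, y)); split; split => //=; apply: eN.
    by rewrite /= distrC (le_lt_trans xd).
  by rewrite /= distrC (le_lt_trans yd).
- have [L L0 LP] := hL _ Ax0; near (0 : R)^'+ => e.
  have e0 : 0 < e by [].
  have LPe : forall x y, A x -> A y -> `|x - x0| <= e -> `|y - x0| <= e ->
      `|h x - h y| <= L * `|x - y| by near: e.
  exists [set x | `|x - x0| <= e].
    by apply/nbhs_normP; exists e => //= x /=; rewrite distrC => /ltW.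
  rewrite /lipschitz_on; near=> M => -[x y] [[/= Ax xe] [Ay ye]].
  apply: le_trans (LPe _ _ Ax Ay xe ye) _; exact: ler_wpM2r.
Unshelve. all: by end_near. Qed.

(** Products and concatenations of locally Lipschitz maps reduce to a bound of
    their increments by the increments of the factors. *)
Lemma locally_lipschitz_on_dominated V W1 W2 W3 (h : V -> W1) (h1 : V -> W2)
    (h2 : V -> W3) (A : set V) :
  locally_lipschitz_on h1 A -> locally_lipschitz_on h2 A ->
  (forall x0, A x0 -> exists2 c, 0 <= c & \forall e \near 0^'+,
    forall x y, A x -> A y -> `|x - x0| <= e -> `|y - x0| <= e ->
      `|h x - h y| <= c * (`|h1 x - h1 y| + `|h2 x - h2 y|)) ->
  locally_lipschitz_on h A.
Proof.
move=> /locally_lipschitz_onP h1L /locally_lipschitz_onP h2L hc.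
apply/locally_lipschitz_onP => x0 Ax0.
have [L1 L10 L1P] := h1L _ Ax0; have [L2 L20 L2P] := h2L _ Ax0.
have [c c0 cP] := hc _ Ax0.
exists (c * (L1 + L2)); first by rewrite mulr_ge0// addr_ge0.
apply: filterS3 L1P L2P cP => e L1P L2P cP x y Ax Ay xe ye.
apply: le_trans (cP _ _ Ax Ay xe ye) _.
rewrite -mulrA mulrDl; apply: ler_wpM2l => //.
by apply: lerD; [exact: L1P|exact: L2P].
Qed.

Lemma locally_lipschitz_on_le V W1 W2 (h : V -> W1) (h1 : V -> W2)
    (A : set V) (c : R) :
  0 <= c -> (forall x y, `|h x - h y| <= c * `|h1 x - h1 y|) ->
  locally_lipschitz_on h1 A -> locally_lipschitz_on h A.
Proof.
move=> c0 hc h1L; apply: (locally_lipschitz_on_dominated h1L h1L) => x0 Ax0.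
exists c => //; apply: nearW => e x y _ _ _ _.
by apply: le_trans (hc x y) _; rewrite ler_wpM2l// lerDl.
Qed.

Lemma locally_lipschitz_onN V W (h : V -> W) (A : set V) :
  locally_lipschitz_on h A -> locally_lipschitz_on (fun x => - h x) A.
Proof.
apply: (@locally_lipschitz_on_le _ _ _ _ _ _ 1) => // x y.
by rewrite mul1r -opprD normrN.
Qed.

Lemma lipschitz_locally_on V W (h : V -> W) (A : set V) :
  lipschitz h -> locally_lipschitz_on h A.
Proof.
move=> hL x Ax; exists setT; first exact: filterT.
move: hL; apply: sub_lipschitz => P.
by rewrite /globally /= => PT y _; apply: PT.
Qed.

Lemma locally_lipschitz_on_comp V W1 W2 (h : V -> W1) (g : W1 -> W2)
    (A : set V) (D : set W1) :
  (forall x, A x -> D (h x)) -> locally_lipschitz_on h A ->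
  locally_lipschitz_on g D -> locally_lipschitz_on (g \o h) A.
Proof.
move=> AD /locally_lipschitz_onP hL /locally_lipschitz_onP gL.
apply/locally_lipschitz_onP => x0 Ax0.
have [L L0 LP] := hL _ Ax0; have [M M0 MP] := gL _ (AD _ Ax0).
exists (M * L); first exact: mulr_ge0.
near (0 : R)^'+ => r; have r0 : 0 < r by [].
have MPr : forall u v, D u -> D v -> `|u - h x0| <= r -> `|v - h x0| <= r ->
  `|g u - g v| <= M * `|u - v| by near: r.
have Lsmall : \forall e \near 0^'+, - r + e * L <= 0.
  by apply: affine_le0_near => [|/eqP]; lra.
near=> e => x y Ax Ay xe ye; have e0 : 0 < e by [].
have LPe : forall x y, A x -> A y -> `|x - x0| <= e -> `|y - x0| <= e ->
  `|h x - h y| <= L * `|x - y| by near: e.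
have Le : L * e <= r.
  have : - r + e * L <= 0 by near: e.
  lra.
have x0e : `|x0 - x0| <= e by rewrite subrr normr0 ltW.
have hr z : A z -> `|z - x0| <= e -> `|h z - h x0| <= r.
  move=> Az ze; rewrite (le_trans (LPe _ _ Az Ax0 ze x0e))//.
  by rewrite (le_trans _ Le)// ler_wpM2l.
apply: le_trans (MPr _ _ (AD _ Ax) (AD _ Ay) (hr _ Ax xe) (hr _ Ay ye)) _.
by rewrite -mulrA ler_wpM2l// LPe.
Unshelve. all: by end_near. Qed.

Lemma norm_mulmx_le p q r (M : 'M[R]_(p, q)) (N : 'M[R]_(q, r)) :
  `|M *m N| <= q%:R * `|M| * `|N|.
Proof.
apply: norm_mx_le => [|i j]; first by rewrite !mulr_ge0.
rewrite mxE (le_trans (ler_norm_sum _ _ _))//.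
have -> : q%:R * `|M| * `|N| = \sum_(l < q) (`|M| * `|N|).
  by rewrite sumr_const card_ord -mulrA mulr_natl.
by apply: ler_sum => l _; rewrite normrM ler_pM// norm_entry_le.
Qed.

Lemma locally_lipschitz_on_mulmx V p q r (h1 : V -> 'M[R]_(p, q))
    (h2 : V -> 'M[R]_(q, r)) (A : set V) :
  locally_lipschitz_on h1 A -> locally_lipschitz_on h2 A ->
  locally_lipschitz_on (fun x => h1 x *m h2 x) A.
Proof.
move=> h1L h2L; apply: (locally_lipschitz_on_dominated h1L h2L) => x0 Ax0.
have bounded s t (h : V -> 'M[R]_(s, t)) : locally_lipschitz_on h A ->
    \forall e \near 0^'+, forall x, A x -> `|x - x0| <= e ->
      `|h x| <= `|h x0| + 1.
  move=> /locally_lipschitz_onP/(_ _ Ax0)[L L0 LP].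
  have Lsmall : \forall e \near 0^'+, - 1 + e * L <= 0.
    by apply: affine_le0_near => [|/eqP]; lra.
  near=> e => x Ax xe; have e0 : 0 < e by [].
  have LPe : forall x y, A x -> A y -> `|x - x0| <= e -> `|y - x0| <= e ->
    `|h x - h y| <= L * `|x - y| by near: e.
  have : - 1 + e * L <= 0 by near: e.
  have := LPe _ _ Ax Ax0 xe; rewrite subrr normr0 (ltW e0) => /(_ isT).
  have := ler_wpM2l L0 xe.
  have := ler_normD (h x0) (h x - h x0); rewrite addrC subrK; lra.
exists (q%:R * (`|h1 x0| + `|h2 x0| + 1)).
  by rewrite !mulr_ge0// !addr_ge0.
apply: filterS2 (bounded _ _ _ h1L) (bounded _ _ _ h2L).
move=> e b1 b2 x y Ax Ay xe ye.
have -> : h1 x *m h2 x - h1 y *m h2 y =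
    h1 x *m (h2 x - h2 y) + (h1 x - h1 y) *m h2 y.
  by rewrite mulmxBr mulmxBl addrA subrK.
apply: le_trans (ler_normD _ _) _.
apply: le_trans (lerD (norm_mulmx_le _ _) (norm_mulmx_le _ _)) _.
rewrite -!mulrA -mulrDr ler_wpM2l//.
have := ler_wpM2r (normr_ge0 (h2 x - h2 y)) (b1 _ Ax xe).
have := ler_wpM2l (normr_ge0 (h1 x - h1 y)) (b2 _ Ay ye).
have := mulr_ge0 (normr_ge0 (h1 x0)) (normr_ge0 (h1 x - h1 y)).
have := mulr_ge0 (normr_ge0 (h2 x0)) (normr_ge0 (h2 x - h2 y)).
lra.
Unshelve. all: by end_near. Qed.

Lemma locally_lipschitz_on_entry V p q (h : V -> 'M[R]_(p, q)) i j (A : set V) :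
  locally_lipschitz_on h A -> locally_lipschitz_on (fun x => h x i j) A.
Proof.
apply: (@locally_lipschitz_on_le _ _ _ _ _ _ 1) => // x y; rewrite mul1r.
by apply: le_trans (norm_entry_le _ i j); rewrite !mxE.
Qed.

Lemma derive_gradient n (B : 'cV[R]_n -> R) x v :
  differentiable B x -> 'D_v B x = (gradient B x *m v) 0 0.
Proof.
move=> dB; rewrite deriveE// mxE [in LHS](matrix_sum_delta v) linear_sum.
apply: eq_bigr => i _; rewrite big_ord1 linearZ /= mxE deriveE//.
by rewrite mulrC.
Qed.

(** Mean value inequality on a small ball, where the gradient is bounded by
    continuity; balls are convex, so segments between their points stay
    inside. *)
Lemma continuously_differentiable_lipschitz n (B : 'cV[R]_n -> R)
    (A : set 'cV[R]_n) :
  continuously_differentiable B -> locally_lipschitz_on B A.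
Proof.
move=> [dB cB]; apply/locally_lipschitz_onP => x0 _.
exists (n%:R * (`|gradient B x0| + 1)); first by rewrite mulr_ge0// addr_ge0.
have /cvgr_dist_le/(_ _ ltr01)/nbhs_normP[d /= d0 gd] := cB x0.
near=> e => x y _ _ xe ye.
have ed : e < d by near: e; apply: nbhs_right_lt.
pose path t := y + t *: (x - y).
have path_in t : t \in `[0, 1]%R -> `|path t - x0| < d.
  rewrite in_itv /= => /andP[t0 t1]; apply: le_lt_trans ed.
  have -> : path t - x0 = t *: (x - x0) + (1 - t) *: (y - x0).
    by apply/matrixP => i j; rewrite /path !mxE; ring.
  apply: le_trans (ler_normD _ _) _; rewrite !normrZ (ger0_norm t0).
  rewrite ger0_norm ?subr_ge0//.
  have := ler_wpM2l t0 xe.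
  have s0 : 0 <= 1 - t by rewrite subr_ge0.
  have := ler_wpM2l s0 ye; lra.
have dpath (t : R) :
    is_derive t (1 : R) (B \o path) ((gradient B (path t) *m (x - y)) 0 0).
  have pathD : is_diff t path (fun s : R => 0 + s *: (x - y)).
    exact: is_diffD.
  have Bpath : differentiable (B \o path) t by exact: differentiable_comp.
  apply: DeriveDef; first exact: diff_derivable.
  rewrite deriveE// diff_comp//=.
  have -> : 'd path t (1 : R) = x - y by rewrite diff_val /= add0r scale1r.
  by rewrite -deriveE// derive_gradient.
have [|c c01] := @MVT_segment R (B \o path)
    (fun t => (gradient B (path t) *m (x - y)) 0 0)
    0 1 ler01 (fun t _ => dpath t).
  by apply: derivable_within_continuous => t _; exact: ex_derive.
rewrite /path /= scale0r scale1r addr0 [y + _]addrC subrK subr0 mulr1 => ->.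
apply: le_trans (norm_entry_le _ 0 0) _.
apply: le_trans (norm_mulmx_le _ _) _.
rewrite ler_wpM2r// ler_wpM2l//.
have := gd (path c); rewrite /= distrC => /(_ (path_in _ c01)).
have := ler_normD (gradient B x0) (gradient B (path c) - gradient B x0).
rewrite [_ + (_ - _)]addrC subrK distrC; lra.
Unshelve. all: by end_near. Qed.

End LocallyLipschitz.

(** * Projection with locally Lipschitz data *)

(** The transversality condition at [x0] alone makes the projection stable
    around [x0]; it is required at each point because each serves as base
    point. *)
Theorem projection_locally_lipschitz (R : realType) (V : normedModType R)
    (k p : nat) (N : 'M[R]_(p, k)) (b : 'cV[R]_p) (C : set V)
    (a : V -> 'cV[R]_k) (r : V -> R) (y z : V -> 'cV[R]_k) :
  locally_lipschitz_on a C -> locally_lipschitz_on r C ->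
  locally_lipschitz_on y C ->
  (forall x, C x ->
     is_projection (cut_polyhedron (a x) (r x) N b) (y x) (z x)) ->
  (forall x, C x -> dot (a x) (z x) + r x = 0 ->
     exists v, transversal_dir N b (a x) (z x) v) ->
  locally_lipschitz_on z C.
Proof.
move=> /locally_lipschitz_onP aL /locally_lipschitz_onP rL.
move=> /locally_lipschitz_onP yL zP zT.
apply/locally_lipschitz_onP => x0 Cx0.
have [La La0 aLP] := aL _ Cx0; have [Lr Lr0 rLP] := rL _ Cx0.
have [Ly Ly0 yLP] := yL _ Cx0.
have [K K0 stable] := projection_lipschitz_near (zP _ Cx0) (zT _ Cx0).
set L := La + Lr + Ly.
have LaL : La <= L by rewrite /L; lra.
have LrL : Lr <= L by rewrite /L; lra.
have LyL : Ly <= L by rewrite /L; lra.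
have L0 : 0 <= L by apply: le_trans LaL.
exists (K * L); first exact: mulr_ge0.
near (0 : R)^'+ => rho; have rho0 : 0 < rho by [].
have stable_rho : forall a1 r1 y1 z1 a2 r2 y2 z2 eps,
    data_close rho a1 r1 y1 (a x0) (r x0) (y x0) ->
    is_projection (cut_polyhedron a1 r1 N b) y1 z1 ->
    data_close rho a2 r2 y2 (a x0) (r x0) (y x0) ->
    is_projection (cut_polyhedron a2 r2 N b) y2 z2 ->
    data_close eps a1 r1 y1 a2 r2 y2 -> `|z1 - z2| <= K * eps by near: rho.
have small : \forall e \near 0^'+, - rho + e * L <= 0.
  by apply: affine_le0_near => [|/eqP]; lra.
have data_lip : \forall e \near 0^'+, forall x x', C x -> C x' ->
    `|x - x0| <= e -> `|x' - x0| <= e ->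
    data_close (L * `|x - x'|) (a x) (r x) (y x) (a x') (r x') (y x').
  apply: filterS3 aLP rLP yLP => e ae re ye x x' Cx Cx' xe xe'.
  split; [apply: le_trans (ae _ _ Cx Cx' xe xe') _
         |apply: le_trans (re _ _ Cx Cx' xe xe') _
         |apply: le_trans (ye _ _ Cx Cx' xe xe') _]; exact: ler_wpM2r.
near=> e => x x' Cx Cx' xe xe'; have e0 : 0 < e by [].
have data_lip_e : forall x x', C x -> C x' ->
    `|x - x0| <= e -> `|x' - x0| <= e ->
    data_close (L * `|x - x'|) (a x) (r x) (y x) (a x') (r x') (y x').
  by near: e.
have Le : L * e <= rho.
  have : - rho + e * L <= 0 by near: e.
  lra.
have x0e : `|x0 - x0| <= e by rewrite subrr normr0 ltW.
have near_base w : C w -> `|w - x0| <= e ->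
    data_close rho (a w) (r w) (y w) (a x0) (r x0) (y x0).
  move=> Cw we; apply: data_closeW (data_lip_e _ _ Cw Cx0 we x0e).
  by apply: le_trans Le; exact: ler_wpM2l.
rewrite -mulrA; apply: (stable_rho _ _ _ _ _ _ _ _ _ (near_base _ Cx xe)
  (zP _ Cx) (near_base _ Cx' xe') (zP _ Cx')).
exact: data_lip_e.
Unshelve. all: by end_near. Qed.

(** * The quadratic program as a projection *)

(** The coordinate of the first vector of a free sequence is a linear form that
    vanishes on the others; [v] represents it. *)
Lemma free_cons_dual (R : fieldType) (k : nat) (g : 'rV[R]_k)
    (s : seq 'rV[R]_k) :
  free (g :: s) ->
  exists v : 'cV[R]_k,
    (g *m v) 0 0 = 1 /\ forall h, h \in s -> (h *m v) 0 0 = 0.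
Proof.
set X := in_tuple (g :: s) => freeX.
pose v : 'cV[R]_k := \col_j coord X ord0 (delta_mx 0 j).
have vE (h : 'rV[R]_k) : (h *m v) 0 0 = coord X ord0 h.
  rewrite [h in RHS]row_sum_delta linear_sum mxE; apply: eq_bigr => j _.
  by rewrite linearZ /= mxE.
exists v; split; first by rewrite vE -[g]/(X`_(@ord0 (size s))) coord_free.
move=> h /[dup] hs; rewrite vE -index_mem => hi.
pose i : 'I_(size (g :: s)) := lift ord0 (Ordinal hi).
by rewrite -(nth_index 0 hs) -[s`_ _]/(X`_i) coord_free.
Qed.

Section SafetyFilter.
Context (R : realType) (m p : nat) (A : 'M[R]_(p, m)) (b : 'cV[R]_p) (ps : R).
Hypothesis ps_gt0 : 0 < ps.

(** In these coordinates the weight [ps] of the slack disappears from the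
    metric; [barrier_normal] is scaled inversely so that the constraint is
    unchanged ([dot_barrier_normal]). *)
Definition weighted (s : R) (u : 'cV[R]_m) : 'cV[R]_(1 + m) :=
  col_mx (Num.sqrt ps * s)%:M u.

Definition barrier_normal (Lam : R) (G : 'rV[R]_m) : 'cV[R]_(1 + m) :=
  col_mx (Lam / Num.sqrt ps)%:M G^T.

Definition input_rows : 'M[R]_(p, 1 + m) := row_mx 0 A.

Let sqrt_ps_gt0 : 0 < Num.sqrt ps. Proof. by rewrite sqrtr_gt0. Qed.

Lemma weighted_surj z : exists s u, z = weighted s u.
Proof.
exists (usubmx z 0 0 / Num.sqrt ps), (dsubmx z).
by rewrite /weighted mulrC divfK ?gt_eqF// -mx11_scalar vsubmxK.
Qed.

Lemma dot_col_mx (s t : R) (u v : 'cV[R]_m) :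
  dot (col_mx s%:M u) (col_mx t%:M v) = s * t + dot u v.
Proof.
rewrite /dot tr_col_mx mul_row_col tr_scalar_mx -scalar_mxM.
by rewrite 2!mxE mulr1n.
Qed.

Lemma dot_barrier_normal F G Lam s u :
  dot (barrier_normal Lam G) (weighted s u) + F = barrier_lhs F G Lam s u.
Proof.
rewrite dot_col_mx /dot trmxK mulrA divfK ?gt_eqF// /barrier_lhs.
by ring.
Qed.

Lemma input_rows_weighted s u : input_rows *m weighted s u = A *m u.
Proof. by rewrite /input_rows /weighted mul_row_col mul0mx add0r. Qed.

Lemma qp_cost_weighted ud s u :
  dot (weighted s u - weighted 1 ud) (weighted s u - weighted 1 ud) =
  2 * qp_cost ps ud s u.
Proof.
rewrite opp_col_mx add_col_mx -raddfN -raddfD dot_col_mx /qp_cost dot_sum.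
under eq_bigr do rewrite -expr2.
have := sqr_sqrtr (ltW ps_gt0); move: (Num.sqrt ps) => q; rewrite expr2 => <-.
by field.
Qed.

Lemma qp_minimizer_projection ud F G Lam s u :
  qp_minimizer ps ud F G Lam A b s u ->
  is_projection (cut_polyhedron (barrier_normal Lam G) F input_rows b)
    (weighted 1 ud) (weighted s u).
Proof.
have feasE s' u' : cut_polyhedron (barrier_normal Lam G) F input_rows b
    (weighted s' u') <-> qp_feasible F G Lam A b s' u'.
  rewrite /cut_polyhedron /qp_feasible /input_set /= dot_barrier_normal.
  by rewrite input_rows_weighted.
move=> [feas opt]; split; first exact/feasE.
move=> w; have [s' [u' ->]] := weighted_surj w.
by move=> /feasE /opt; rewrite !qp_cost_weighted ler_pM2l.
Qed.

Lemma nondegenerate_transversal F G Lam s u :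
  primal_nondegenerate F G Lam A b s u -> barrier_lhs F G Lam s u = 0 ->
  exists v,
    transversal_dir input_rows b (barrier_normal Lam G) (weighted s u) v.
Proof.
rewrite /primal_nondegenerate /active_gradients => + act; rewrite act eqxx /=.
move=> /free_cons_dual[v [gv rv]].
have [t [w vE]] : exists t w, v = col_mx t%:M w.
  by exists (usubmx v 0 0), (dsubmx v); rewrite -mx11_scalar vsubmxK.
rewrite {}vE in gv rv.
exists (weighted t w); split.
  rewrite -[dot _ _]addr0 dot_barrier_normal /barrier_lhs add0r.
  move: gv; rewrite mul_row_col -scalar_mxM 2!mxE mulr1n; lra.
move=> i; rewrite !input_rows_weighted => ui.
have := rv (row_mx 0 (row i A)); rewrite mul_row_col mul0mx add0r.
rewrite -row_mul [X in X = 0]mxE; apply; apply/map_f.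
by rewrite mem_filter ui eqxx mem_enum.
Qed.

End SafetyFilter.

(** * Lipschitz continuity of the control law *)

Lemma locally_lipschitz_on_col_mx (R : realType) (V : normedModType R) (m : nat)
    (h : V -> R) (u : V -> 'cV[R]_m) (c : R) (A : set V) :
  locally_lipschitz_on h A -> locally_lipschitz_on u A ->
  locally_lipschitz_on (fun x => col_mx (h x * c)%:M (u x) : 'cV[R]_(1 + m)) A.
Proof.
move=> hL uL; apply: (locally_lipschitz_on_dominated hL uL) => x0 _.
exists (`|c| + 1); first by rewrite addr_ge0.
apply: nearW => e x y _ _ _ _; rewrite opp_col_mx add_col_mx -raddfN -raddfD.
rewrite -mulrBl.
have c1 : `|c| <= `|c| + 1 by rewrite lerDl.
apply: norm_mx_le => [|i j]; first by rewrite mulr_ge0 ?addr_ge0.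
rewrite mxE; case: splitP => l _.
  rewrite !ord1 mxE eqxx mulr1n normrM mulrC.
  by apply: ler_pM => //; rewrite lerDl.
apply: le_trans (norm_entry_le _ _ _) _.
have := mulr_ge0 (normr_ge0 c) (normr_ge0 (h x - h y)).
have := mulr_ge0 (normr_ge0 c) (normr_ge0 (u x - u y)).
have := normr_ge0 (h x - h y); lra.
Qed.

Theorem theorem4 (R : realType) (n m p : nat)
    (f : 'cV[R]_n -> 'cV[R]_n) (g : 'cV[R]_n -> 'M[R]_(n, m))
    (A : 'M[R]_(p, m)) (b : 'cV[R]_p)
    (B : 'cV[R]_n -> R) (C : set 'cV[R]_n)
    (c d : \bar R) (alpha : R -> R)
    (udes : 'cV[R]_n -> 'cV[R]_m) (ps : R)
    (sstar : 'cV[R]_n -> R) (ustar : 'cV[R]_n -> 'cV[R]_m)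
    (F := fun x => - lie_f f B x)
    (G := fun x => - lie_g g B x)
    (Lam := fun x => - alpha (B x))
    (f_lip : lipschitz f) (g_lip : lipschitz g)
    (B_cbf : control_barrier_function f g (input_set A b) B C)
    (alpha_K : ext_class_K c d alpha)
    (alpha_dom : forall x, C x -> classK_domain c d (B x))
    (udes_U : forall x, input_set A b (udes x))
    (ps_gt0 : 0 < ps)
    (gradB_lip : locally_lipschitz_on (gradient B) C)
    (alpha_lip : locally_lipschitz_on alpha (classK_domain c d))
    (udes_lip : locally_lipschitz_on udes C)
    (G_neq0 : forall x, C x -> G x != 0)
    (star_min : forall x, C x ->
      qp_minimizer ps (udes x) (F x) (G x) (Lam x) A b (sstar x) (ustar x))
    (nondeg : forall x, C x ->
      primal_nondegenerate (F x) (G x) (Lam x) A b (sstar x) (ustar x)) :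
  locally_lipschitz_on ustar C.
Proof.
have F_lip : locally_lipschitz_on F C.
  apply: locally_lipschitz_onN; apply: locally_lipschitz_on_entry.
  exact: locally_lipschitz_on_mulmx gradB_lip (lipschitz_locally_on f_lip).
have G_lip : locally_lipschitz_on G C.
  apply: locally_lipschitz_onN.
  exact: locally_lipschitz_on_mulmx gradB_lip (lipschitz_locally_on g_lip).
have B_lip : locally_lipschitz_on B C.
  by case: B_cbf => B_C1 _ _; apply: continuously_differentiable_lipschitz.
have Lam_lip : locally_lipschitz_on Lam C.
  apply: locally_lipschitz_onN.
  exact: locally_lipschitz_on_comp alpha_dom B_lip alpha_lip.
have GT_lip : locally_lipschitz_on (fun x => (G x)^T) C.
  apply: (locally_lipschitz_on_le (c := 1)) G_lip => // x y.
  rewrite mul1r -linearB; apply: norm_mx_le => // i j.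
  by rewrite mxE norm_entry_le.
pose z x := weighted ps (sstar x) (ustar x).
have normal_lip :
    locally_lipschitz_on (fun x => barrier_normal ps (Lam x) (G x)) C.
  exact: locally_lipschitz_on_col_mx Lam_lip GT_lip.
have target_lip : locally_lipschitz_on (fun x => weighted ps 1 (udes x)) C.
  apply: (locally_lipschitz_on_col_mx (h := fun=> Num.sqrt ps) 1 _ udes_lip).
  apply: (locally_lipschitz_on_le (c := 1)) udes_lip => // x y.
  by rewrite subrr normr0 mul1r.
have z_lip : locally_lipschitz_on z C.
  apply: (projection_locally_lipschitz normal_lip F_lip target_lip) => x Cx.
    exact: qp_minimizer_projection (star_min x Cx).
  rewrite dot_barrier_normal//; exact: nondegenerate_transversal (nondeg x Cx).
apply: (locally_lipschitz_on_le (c := 1)) z_lip => // x y.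
rewrite mul1r opp_col_mx add_col_mx; apply: norm_mx_le => // i j.
set M := col_mx _ _; have := norm_entry_le M (rshift 1 i) j.
by rewrite /M col_mxEd.
Qed.
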